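(* Let $X$ be any real or complex separable infinite-dimensional Banach space and let $N\in\mathbb{N}$. There exists a bounded linear operator $T:X\to X$ such that the $N$-fold direct sum $T_{(N)}=T\oplus\cdots\oplus T$ on $X^N$ satisfies $\mathrm{Rec}(T_{(N)})=X^N$ (in particular $T_{(N)}$ is recurrent), while the $(N+1)$-fold direct sum $T_{(N+1)}$ on $X^{N+1}$ is not recurrent. In particular (taking $N=1$), there exists a recurrent operator $T$ on $X$ such that $T\oplus T$ is not recurrent.
   Context: For an operator $S$ on a space $Y$, a vector $y$ is recurrent if $y\in\overline{\{S^ny:n\geq1\}}$; $\mathrm{Rec}(S)$ denotes the set of recurrent vectors, and $S$ is recurrent if $\mathrm{Rec}(S)$ is dense in $Y$. $T_{(N)}(x_1,\dots,x_N)=(Tx_1,\dots,Tx_N)$ on the direct sum $X^N$. *)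

(* Defs.v *)
From mathcomp Require Import all_boot all_algebra.
From mathcomp Require Import all_classical all_reals all_analysis.
From mathcomp Require Export complex.
Import numFieldNormedType.Exports.
Import GRing.Theory.

Set Implicit Arguments.
Unset Strict Implicit.
Unset Printing Implicit Defensive.

Local Open Scope classical_set_scope.
Local Open Scope ring_scope.

Definition recurrent_vector (Y : topologicalType) (S : Y -> Y) (y : Y) : Prop :=
  closure [set iter n.+1 S y | n in [set: nat]] y.

Definition Rec (Y : topologicalType) (S : Y -> Y) : set Y :=
  [set y | recurrent_vector S y].

Definition recurrent_op (Y : topologicalType) (S : Y -> Y) : Prop :=
  closure (Rec S) = setT.

Definition dsum_space (X : topologicalType) (N : nat) : topologicalType :=
  {ptws 'I_N -> X}.

Definition dsum_op (X : topologicalType) (N : nat) (T : X -> X)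
  : dsum_space X N -> dsum_space X N :=
  fun x : {ptws 'I_N -> X} => (fun i : 'I_N => T (x i)) : {ptws 'I_N -> X}.

Arguments dsum_op {X} N T _.

Definition separable (X : topologicalType) : Prop :=
  exists D : set X, countable D /\ closure D = setT.

Definition infinite_dimensional (K : numFieldType) (X : lmodType K) : Prop :=
  forall (n : nat) (e : 'I_n -> X),
    exists v : X, forall c : 'I_n -> K, v <> \sum_(i < n) c i *: e i.

Definition recurrence_gap (K : numFieldType) (X : completeNormedModType K)
  (N : nat) : Prop :=
  exists T : {linear X -> X},
    continuous T /\
    Rec (dsum_op N T) = setT /\
    ~ recurrent_op (dsum_op N.+1 T).

(* Main.v *)
From HB Require Import structures.
Require Import Defs.
From mathcomp Require Import all_boot all_order all_algebra.
From mathcomp Require Import all_classical all_reals all_analysis.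
From mathcomp Require Import complex zify ring lra.
Import numFieldNormedType.Exports.
Import Order.TTheory GRing.Theory Num.Theory.

Local Open Scope classical_set_scope.
Local Open Scope ring_scope.

(** Take a biorthogonal sequence (e_i, g_i) with |e_i| = 1 and |g_i| <= 8, and
    periods M_0 = 1, M_(k+1) = (k+4) M_k.  Let A_k be the rotation by the angle
    2 pi / M_(k+1) acting on the k-th pair of basis vectors beyond e_0, ..., e_N,
    and put y_k(x) = (g_(l k) x + b_k w_k(x), g_(r k) x), where w_k is a
    combination of g_0, ..., g_N and b_k is the reciprocal of the distance
    |exp(2 pi i / (k+4)) - 1|.  Then T x = x + sum_k (A_k - 1) y_k(x) is bounded
    and T^n x - x = sum_k (A_k^n - 1) y_k(x).

    At time n = M_k the blocks before k vanish, those after k are negligible, and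
    the k-th one is about w_k(x).  The w_k are dense among normalised
    combinations and N vectors are annihilated by a common one, so the
    N-fold sum recurs everywhere.  Conversely, given n >= 1, take k with M_k | n
    and not M_(k+1) | n: then |T^n x - x| is at least a multiple of |w_k(x)|, which
    cannot be small for all N+1 vectors close to e_0, ..., e_N.

    Real scalars are embedded in the field of scalars and rotations are written
    as real 2 x 2 matrices, so that both fields are treated at once. *)

Set Implicit Arguments.
Unset Strict Implicit.
Unset Printing Implicit Defensive.

(** * Trigonometric estimates for the rotations and their periods *)

Section Rotations.
Variable R : realType.
Implicit Types x : R.

Lemma sin_MVT x : 0 <= x -> exists2 c, c \in `[0, x] & sin x = cos c * x.
Proof.
move=> x0; have [c ci] : exists2 c, c \in `[0, x] & sin x - sin 0 = cos c * (x - 0).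
  apply: (@MVT_segment R sin cos) => //.
  exact/continuous_subspaceT/continuous_sin.
by rewrite sin0 !subr0 => ->; exists c.
Qed.

Lemma norm_sin_le x : 0 <= x -> `|sin x| <= x.
Proof.
move=> x0; have [c _ ->] := sin_MVT x0.
by rewrite normrM (ger0_norm x0) ler_piMl // cos_max.
Qed.

Lemma sin_ge_half x : 0 <= x <= pi / 4 -> x / 2 <= sin x.
Proof.
move=> /andP[x0 x4]; have [c] := sin_MVT x0.
rewrite in_itv /= => /andP[c0 cx] ->.
rewrite mulrC ler_wpM2r //.
have pi0 := pi_gt0 R.
have c1 : 0 <= cos c by apply: cos_ge0_pihalf; lra.
(* Nonnegativity of [cos (2c) = 2 cos^2 c - 1], together with [cos c >= 0], forces
   [cos c >= 1/2]. *)
have : 0 <= cos (c *+ 2) by apply: cos_ge0_pihalf; rewrite (mulr2n c); lra.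
rewrite cos_mulr2n; nra.
Qed.

Lemma sinDnpi n x : `|sin (x + n%:R * pi)| = `|sin x|.
Proof.
elim: n => [|n IH]; first by rewrite mul0r addr0.
by rewrite -natr1 mulrDl mul1r addrA -IH sinDpi normrN.
Qed.

Lemma sin_pi_div_gt0 p : (1 < p)%N -> 0 < sin (pi / p%:R : R).
Proof.
move=> p1; have pi0 := pi_gt0 R.
have p0 : 0 < p%:R :> R by rewrite ltr0n (ltn_trans _ p1).
apply: sin_gt0_pi; rewrite divr_gt0 //= ltr_pdivrMr // ltr_pMr //.
by rewrite ltr1n.
Qed.

(** Modulo [pi] the angle is [r * pi / p] with [0 < r < p]. The reflection [r -> p - r] brings it
    into [[pi / p, pi / 2]], where [sin] increases. *)
Lemma sin_pi_div_min p q : (1 < p)%N -> ~~ (p %| q)%N ->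
  sin (pi / p%:R : R) <= `|sin (q%:R * (pi / p%:R))|.
Proof.
move=> p1 pq; have pi0 := pi_gt0 R.
have p0 : 0 < p%:R :> R by rewrite ltr0n (ltn_trans _ p1).
have p0' : (p%:R : R) != 0 by rewrite gt_eqF.
have p2 : 2 <= p%:R :> R by rewrite (ler_nat R 2 p).
pose r := (q %% p)%N.
have r0 : (1 <= r)%N by rewrite lt0n; move: pq; rewrite /dvdn.
have rp : (r.+1 <= p)%N by rewrite ltn_mod (ltn_trans _ p1).
have -> : q%:R * (pi / p%:R) = r%:R * (pi / p%:R) + (q %/ p)%N%:R * pi :> R.
  rewrite {1}(divn_eq q p) -/r natrD natrM; field.
  exact: p0'.
rewrite sinDnpi; apply: le_trans (ler_norm _).
have key t : 1 <= t -> t * (pi / p%:R) <= pi / 2 ->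
    sin (pi / p%:R) <= sin (t * (pi / p%:R)) :> R.
  move=> t1 t2; have pp : 0 < pi / p%:R :> R by rewrite divr_gt0.
  have le1 : pi / p%:R <= t * (pi / p%:R) by rewrite ler_peMl // ltW.
  by rewrite leNgt ltr_sin -?leNgt // in_itv /=; lra.
have [h|h] := leP (r%:R * (pi / p%:R)) (pi / 2 : R).
  by apply: key => //; rewrite ler1n.
have -> : sin (r%:R * (pi / p%:R)) = sin ((p%:R - r%:R) * (pi / p%:R)) :> R.
  have -> : (p%:R - r%:R) * (pi / p%:R) = - (r%:R * (pi / p%:R)) + pi :> R.
    by field.
  by rewrite sinDpi sinN opprK.
apply: key.
  by rewrite lerBrDl -[1]/(1%:R) -natrD ler_nat addn1.
have -> : (p%:R - r%:R) * (pi / p%:R) = pi - (r%:R * (pi / p%:R)) :> R by field.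
lra.
Qed.

(** In closed form [(k + 3)! / 6]. The factors tend to infinity, so that at time [period k] the
    blocks after [k] have hardly moved, and they are at least 4, which keeps [pi / (k + 4)] within
    the range of [sin_ge_half]. *)
Definition period k := (\prod_(i < k) (i + 4))%N.

Lemma period0 : period 0 = 1%N. Proof. exact: big_ord0. Qed.

Lemma periodS k : period k.+1 = (period k * (k + 4))%N.
Proof. by rewrite /period big_ord_recr. Qed.

Lemma period_gt0 k : (0 < period k)%N.
Proof. by elim: k => [|k IH]; rewrite ?period0 // periodS muln_gt0 IH addnC. Qed.

Lemma period_ge k : (k.+1 <= period k)%N.
Proof.
elim: k => [|k IH]; rewrite ?period0 // periodS.
have := period_gt0 k; nia.
Qed.

Lemma dvdn_period j k : (j <= k)%N -> (period j %| period k)%N.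
Proof.
move=> /subnK <-; elim: (k - j)%N => // m IH.
by rewrite addSn periodS dvdn_mulr.
Qed.

(** The least index whose period does not divide [n] exists because [period n > n], and it is a
    successor because [period 0 = 1]. *)
Lemma period_block n : (0 < n)%N ->
  exists2 k, (period k %| n)%N & ~~ (period k.+1 %| n)%N.
Proof.
move=> n0; have ex : exists k, ~~ (period k %| n)%N.
  exists n; apply/negP => /dvdn_leq -/(_ n0); have := period_ge n; lia.
case: (ex_minnP ex) => -[|k]; first by rewrite period0 dvd1n.
move=> kn kmin; exists k => //; apply/negPn/negP => /kmin; lia.
Qed.

(** The [n]-th power of rotation [k] turns by twice this angle; the half suits the identity
    [|exp(2it) - 1| = 2 |sin t|], which is what [chord] measures. *)
Definition half_angle k n : R := n%:R * (pi / (period k.+1)%:R).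
Definition chord k n : R := 2 * `|sin (half_angle k n)|.
Definition rot_cos k n : R := cos (half_angle k n *+ 2).
Definition rot_sin k n : R := sin (half_angle k n *+ 2).
Definition gain k : R := (chord k (period k))^-1.

Lemma half_angleD k m n : half_angle k (m + n) = half_angle k m + half_angle k n.
Proof. by rewrite /half_angle natrD mulrDl. Qed.

Lemma half_angle_ge0 k n : 0 <= half_angle k n.
Proof. by rewrite mulr_ge0 // divr_ge0 // pi_ge0. Qed.

Lemma rot_cosD k m n :
  rot_cos k (m + n) = rot_cos k m * rot_cos k n - rot_sin k m * rot_sin k n.
Proof. by rewrite /rot_cos half_angleD mulrnDl cosD. Qed.

Lemma rot_sinD k m n :
  rot_sin k (m + n) = rot_sin k m * rot_cos k n + rot_cos k m * rot_sin k n.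
Proof. by rewrite /rot_sin half_angleD mulrnDl sinD. Qed.

Lemma chord_ge0 k n : 0 <= chord k n.
Proof. by rewrite mulr_ge0. Qed.

Lemma rot_cosB1 k n : rot_cos k n - 1 = - (chord k n ^+ 2 / 2).
Proof.
rewrite /rot_cos cos_mulr2n /chord exprMn real_normK ?num_real //.
rewrite cos2sin2; lra.
Qed.

Lemma rot_sqr k n : rot_cos k n ^+ 2 + rot_sin k n ^+ 2 = 1.
Proof. exact: cos2Dsin2. Qed.

Lemma rot_chord_sqr k n :
  (rot_cos k n - 1) ^+ 2 + rot_sin k n ^+ 2 = chord k n ^+ 2.
Proof. have := rot_sqr k n; have := rot_cosB1 k n; nra. Qed.

Lemma norm_rot_cosB1_le k n : `|rot_cos k n - 1| <= chord k n.
Proof.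
rewrite -[leRHS]ger0_norm ?chord_ge0 // -ler_sqr ?nnegrE // !real_normK ?num_real //.
by rewrite -rot_chord_sqr lerDl sqr_ge0.
Qed.

Lemma norm_rot_sin_le k n : `|rot_sin k n| <= chord k n.
Proof.
rewrite -[leRHS]ger0_norm ?chord_ge0 // -ler_sqr ?nnegrE // !real_normK ?num_real //.
by rewrite -rot_chord_sqr lerDr sqr_ge0.
Qed.

Lemma chord_dvd k n : (period k.+1 %| n)%N -> chord k n = 0.
Proof.
move=> /dvdnP[q ->]; rewrite /chord /half_angle natrM -mulrA mulrCA.
have m0 : (period k.+1)%:R != 0 :> R by rewrite pnatr_eq0 -lt0n period_gt0.
have -> : (period k.+1)%:R * (q%:R * (pi / (period k.+1)%:R)) = 0 + q%:R * pi :> R.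
  by field.
by rewrite sinDnpi sin0 normr0 mulr0.
Qed.

Lemma half_angle_period k q :
  half_angle k (period k * q) = q%:R * (pi / (k + 4)%N%:R).
Proof.
have m0 : (period k)%:R != 0 :> R by rewrite pnatr_eq0 -lt0n period_gt0.
have k0 : (k + 4)%:R != 0 :> R by rewrite pnatr_eq0 addnC.
by rewrite /half_angle periodS !natrM; field; rewrite -natrD k0.
Qed.

Lemma sin_pi_div4_gt0 k : 0 < sin (pi / (k + 4)%N%:R : R).
Proof. by apply: sin_pi_div_gt0; rewrite addnC. Qed.

Lemma chord_period k : chord k (period k) = 2 * sin (pi / (k + 4)%N%:R).
Proof.
rewrite -[in X in chord _ X](muln1 (period k)) /chord half_angle_period mul1r.
by rewrite ger0_norm // ltW // sin_pi_div4_gt0.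
Qed.

Lemma chord_period_gt0 k : 0 < chord k (period k).
Proof. by rewrite chord_period mulr_gt0 // sin_pi_div4_gt0. Qed.

Lemma gain_gt0 k : 0 < gain k.
Proof. by rewrite invr_gt0 chord_period_gt0. Qed.

Lemma gain_ge k : 2^-1 <= gain k.
Proof.
by rewrite lef_pV2 ?posrE ?chord_period_gt0 // chord_period ler_piMr // sin_le1.
Qed.

Lemma chord_gain k : chord k (period k) * gain k = 1.
Proof. by rewrite divff // gt_eqF // chord_period_gt0. Qed.

(** Here [n = q * period k] with [k + 4] not dividing [q], so by [sin_pi_div_min] the chord is no
    shorter than for [q = 1], where it is the inverse of [gain k]. *)
Lemma chord_gain_ge1 k n : (period k %| n)%N -> ~~ (period k.+1 %| n)%N ->
  1 <= chord k n * gain k.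
Proof.
move=> /dvdnP[q ->]; rewrite mulnC periodS dvdn_pmul2l ?period_gt0 // => kq.
rewrite ler_pdivlMr ?chord_period_gt0 // mul1r chord_period ler_pM2l //.
by rewrite half_angle_period; apply: sin_pi_div_min => //; rewrite addnC.
Qed.

Lemma chord_le k n : chord k n <= 8 * n%:R / (period k.+1)%:R.
Proof.
have := norm_sin_le (half_angle_ge0 k n).
rewrite /chord; set s := `|_|; rewrite /half_angle => h.
have pi4 : pi <= 4 :> R by have := pihalf_lt2 R; lra.
suff : n%:R * (pi / (period k.+1)%:R) <= n%:R * (4 / (period k.+1)%:R) :> R.
  by move=> h2; lra.
by rewrite ler_wpM2l // ler_wpM2r // invr_ge0.
Qed.

Lemma natr_addn4_ge k : 4 <= (k + 4)%N%:R :> R.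
Proof. by rewrite (ler_nat R 4 (k + 4)) leq_addl. Qed.

(** The gains are unbounded, but [gain k <= k + 4], and this factor only turns [period k.+1] into
    [period k] in [chord_le]; the bound remains summable over [k]. *)
Lemma chord_gain_le k n : chord k n * gain k <= 8 * n%:R / (period k)%:R.
Proof.
have k0 : 0 < (k + 4)%N%:R :> R by rewrite ltr0n addnC.
have m0 : 0 < (period k)%:R :> R by rewrite ltr0n period_gt0.
have pi0 := pi_gt0 R.
have g1 : gain k <= (k + 4)%N%:R.
  rewrite -[leRHS]invrK lef_pV2 ?posrE ?invr_gt0 ?chord_period_gt0 //.
  rewrite chord_period.
  have : pi / (k + 4)%N%:R / 2 <= sin (pi / (k + 4)%N%:R) :> R.
    apply: sin_ge_half; rewrite divr_ge0 ?pi_ge0 //= ler_pM2l //.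
    by rewrite lef_pV2 ?posrE // natr_addn4_ge.
  have : (k + 4)%N%:R^-1 <= pi / (k + 4)%N%:R :> R.
    by rewrite ler_peMl ?invr_ge0 ?ltW // (lt_le_trans _ (pi_ge2 R)) // ltr1n.
  lra.
apply: le_trans (ler_pM (chord_ge0 k n) (ltW (gain_gt0 k)) (chord_le k n) g1) _.
by rewrite periodS natrM invfM -!mulrA mulVf ?mulr1 // gt_eqF.
Qed.

Lemma chord_le_period k n : chord k n <= 16 * n%:R / (period k)%:R.
Proof.
have := chord_gain_le k n; have := gain_ge k; have := chord_ge0 k n; nra.
Qed.

Lemma chord_period_le k : chord k (period k) <= 8 / (k + 4)%N%:R.
Proof.
apply: le_trans (chord_le _ _) _.
have m0 : (period k)%:R != 0 :> R by rewrite pnatr_eq0 -lt0n period_gt0.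
by rewrite periodS natrM invfM mulrA mulfK.
Qed.

(** A telescoping form: summed from [m] on, the inverse periods amount to at most [2 / period m]. *)
Lemma period_inv_step k :
  (period k)%:R^-1 <= 2 / (period k)%:R - 2 / (period k.+1)%:R :> R.
Proof.
have m0 : 0 < (period k)%:R^-1 :> R by rewrite invr_gt0 ltr0n period_gt0.
rewrite periodS natrM invfM.
have : (k + 4)%N%:R^-1 <= 4^-1 :> R.
  by rewrite lef_pV2 ?posrE ?natr_addn4_ge // ltr0n addnC.
nra.
Qed.

End Rotations.

(** * Real-valued norms over a field of scalars containing the reals *)

Record real_scalars (R : realType) (K : numFieldType) := RealScalars {
  emb : {rmorphism R -> K};
  rho : K -> R;
  emb_le : forall x y, (emb x <= emb y) = (x <= y);
  emb_rho : forall a, 0 <= a -> emb (rho a) = a }.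

Section RealNorm.
Variables (R : realType) (K : numFieldType) (S : real_scalars R K).
Local Notation io := (emb S).

(** Norms over [K] take their values in [K]; read in [R], they are open to suprema and to linear
    arithmetic. *)
Definition nm (V : normedZmodType K) (x : V) : R := rho S `|x|.

Lemma emb_lt x y : (io x < io y) = (x < y).
Proof. by rewrite !lt_def emb_le fmorph_eq. Qed.

Lemma emb_nm (V : normedZmodType K) (x : V) : io (nm x) = `|x|.
Proof. exact: emb_rho. Qed.

Lemma norm_lt_emb (V : normedZmodType K) (x : V) e : (`|x| < io e) = (nm x < e).
Proof. by rewrite -emb_nm emb_lt. Qed.

Lemma emb_pos (e : K) : 0 < e -> exists2 r, 0 < r & io r = e.
Proof.
move=> e0; exists (rho S e); last by rewrite emb_rho // ltW.
by rewrite -emb_lt emb_rho ?ltW // rmorph0.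
Qed.

Section Zmod.
Variable V : normedZmodType K.
Implicit Types x y : V.

Lemma nm_ge0 x : 0 <= nm x.
Proof. by rewrite -(emb_le S) emb_nm rmorph0. Qed.

Lemma nm0 : nm (0 : V) = 0.
Proof. by apply: (fmorph_inj io); rewrite emb_nm rmorph0 normr0. Qed.

Lemma nmD x y : nm (x + y) <= nm x + nm y.
Proof. by rewrite -(emb_le S) rmorphD !emb_nm ler_normD. Qed.

Lemma nmN x : nm (- x) = nm x.
Proof. by apply: (fmorph_inj io); rewrite !emb_nm normrN. Qed.

Lemma nmBC x y : nm (x - y) = nm (y - x).
Proof. by rewrite -nmN opprB. Qed.

Lemma nmB x y : nm (x - y) <= nm x + nm y.
Proof. by rewrite -(nmN y) nmD. Qed.

Lemma nm_eq0 x : nm x = 0 -> x = 0.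
Proof.
by move=> x0; apply/normr0_eq0; rewrite -emb_nm x0 rmorph0.
Qed.

Lemma nm_gt0 x : x != 0 -> 0 < nm x.
Proof.
by rewrite lt_def nm_ge0 andbT; apply: contraNneq => /nm_eq0 ->.
Qed.

Lemma nm_sum (I : Type) (r : seq I) (P : pred I) (F : I -> V) :
  nm (\sum_(i <- r | P i) F i) <= \sum_(i <- r | P i) nm (F i).
Proof.
elim/big_ind2 : _ => [|x1 x2 y1 y2 h1 h2|//]; first by rewrite nm0.
exact: le_trans (nmD _ _) (lerD h1 h2).
Qed.

End Zmod.

Lemma nmM (a b : K) : nm (a * b) = nm a * nm b.
Proof. by apply: (fmorph_inj io); rewrite rmorphM !emb_nm normrM. Qed.

Lemma nm1 : nm (1 : K) = 1.
Proof. by apply: (fmorph_inj io); rewrite emb_nm rmorph1 normr1. Qed.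

Lemma nmV (a : K) : nm a^-1 = (nm a)^-1.
Proof. by apply: (fmorph_inj io); rewrite fmorphV !emb_nm normfV. Qed.

Lemma nm_emb (r : R) : nm (io r) = `|r|.
Proof.
apply: (fmorph_inj io); rewrite emb_nm.
have [r0|r0] := leP 0 r.
  by rewrite !ger0_norm // -(rmorph0 io) emb_le.
by rewrite !ler0_norm ?rmorphN ?ltW // -(rmorph0 io) emb_lt.
Qed.

Lemma nmZ (X : normedModType K) (a : K) (x : X) : nm (a *: x) = nm a * nm x.
Proof. by apply: (fmorph_inj io); rewrite rmorphM !emb_nm normrZ. Qed.

Lemma nbhs_nmP (X : normedModType K) (x : X) (A : set X) :
  nbhs x A <-> exists2 e, 0 < e & forall y, nm (x - y) < e -> A y.
Proof.
rewrite nbhs_ballP; split=> [[e /= e0 eA]|[e e0 eA]].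
  have [r r0 er] := emb_pos e0; exists r => // y xy.
  by apply: eA; rewrite -ball_normE /ball_ /= -er norm_lt_emb.
exists (io e); first by rewrite /= -(rmorph0 io) emb_lt.
by move=> y; rewrite -ball_normE /ball_ /= norm_lt_emb; exact: eA.
Qed.

(** Completeness with a rate: the bound [a n] passes to the limit because [s (maxn N n)] is both
    close to [l] and within [a n] of [s n]. *)
Lemma nm_telescope_cvg (X : completeNormedModType K) (s : nat -> X) (a : nat -> R) :
  (forall e, 0 < e -> exists n, a n < e) ->
  (forall n m, (n <= m)%N -> nm (s m - s n) <= a n) ->
  exists l, forall n, nm (l - s n) <= a n.
Proof.
move=> a0 sa; have : cauchy (s @ \oo).
  apply/cauchy_ballP => e e0.
  have [r r0 <-] := emb_pos e0; have [n an] := a0 _ (divr_gt0 r0 (ltr0Sn R 1)).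
  exists ([set s k | k in [set k | (n <= k)%N]], [set s k | k in [set k | (n <= k)%N]]).
    by split; exists n => // k /= nk; exists k.
  move=> [_ _] /= [[i ni <-] [j nj <-]].
  rewrite -ball_normE /ball_ /= norm_lt_emb.
  have -> : s i - s j = (s i - s n) - (s j - s n) by rewrite opprB addrA subrK.
  by have := nmB (s i - s n) (s j - s n); have := sa _ _ ni; have := sa _ _ nj; lra.
move=> /cauchy_cvg/cvg_ex[l sl]; exists l => n.
apply/ler_addgt0Pr => e e0.
have /sl : nbhs l [set y | nm (l - y) < e] by apply/nbhs_nmP; exists e.
case=> N _ /= /(_ (maxn N n) (leq_maxl _ _)) h.
have -> : l - s n = (l - s (maxn N n)) + (s (maxn N n) - s n) by rewrite addrA subrK.
apply: le_trans (nmD _ _) _; rewrite addrC lerD ?sa ?leq_maxr //.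
exact: ltW h.
Qed.

(** * The Hahn-Banach theorem for real-linear forms, and separation from a subspace *)

Section HahnBanach.
Variables (X : normedModType K) (c : R).
Hypothesis c_ge0 : 0 <= c.

(** Partial real-linear forms are encoded by their graphs, so that extension is inclusion.
    Domination makes them single-valued: [(0, a - b)] in the graph forces [a <= b]. *)
Definition dominated_graph (G : set (X * R)) :=
  [/\ G (0, 0),
      forall x y a b r, G (x, a) -> G (y, b) -> G (x + io r *: y, a + r * b)
    & forall x a, G (x, a) -> a <= c * nm x].

(** The value at [x0] must lie above every [a - c |y - x0|] and below every [c |z + x0| - b]. The
    triangle inequality makes this possible, and [c0] is the supremum of the lower bounds. *)
Lemma dominated_graph_extend (G : set (X * R)) (x0 : X) : dominated_graph G ->
  exists c0 : R, dominated_graph [set p | exists y a r,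
    [/\ G (y, a), p.1 = y + io r *: x0 & p.2 = a + r * c0]].
Proof.
move=> [G0 Gl Gd].
pose A := [set t | exists y a, G (y, a) /\ t = a - c * nm (y - x0)].
have bnd y a z b : G (y, a) -> G (z, b) ->
    a - c * nm (y - x0) <= c * nm (z + x0) - b.
  move=> ya zb; have /Gd := Gl _ _ _ _ 1 ya zb.
  rewrite rmorph1 scale1r mul1r.
  have -> : y + z = (y - x0) + (z + x0) by rewrite addrACA addNr addr0.
  have := ler_wpM2l c_ge0 (nmD (y - x0) (z + x0)); rewrite mulrDr.
  move=> h1 h2. lra.
have A0 : A !=set0 by exists (0 - c * nm (0 - x0)); exists 0, 0.
have Aub z b : G (z, b) -> ubound A (c * nm (z + x0) - b).
  by move=> zb _ [y [a [ya ->]]]; exact: bnd.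
have Ahub : has_ubound A by eexists; exact: Aub G0.
pose c0 := sup A.
have c0l y a : G (y, a) -> a - c * nm (y - x0) <= c0.
  by move=> ya; apply: ub_le_sup => //; exists y, a.
have c0u z b : G (z, b) -> c0 <= c * nm (z + x0) - b.
  by move=> zb; apply: ge_sup => //; exact: Aub.
have Gs y a r : G (y, a) -> G (io r *: y, r * a).
  by move=> ya; have := Gl _ _ _ _ r G0 ya; rewrite !add0r.
exists c0; split.
- by exists 0, 0, 0; rewrite rmorph0 scale0r mul0r !addr0.
- move=> x y a b r /= [x' [a' [s [Gx -> ->]]]] [y' [b' [t [Gy -> ->]]]].
  exists (x' + io r *: y'), (a' + r * b'), (s + r * t); split; first exact: Gl.
    by rewrite rmorphD rmorphM scalerDl scalerDr scalerA addrACA.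
  by ring.
- move=> x a /= [y [b [r [Gy -> ->]]]].
  have [r0|r0|->] := ltgtP r 0; last first.
    by rewrite rmorph0 scale0r mul0r !addr0; exact: Gd.
  (* Dividing by [|r|] reduces [y + r x0] to a graph point plus or minus [x0]: the upper bound on
     [c0] serves [r > 0], the lower one [r < 0]. *)
  + have := c0u _ _ (Gs _ _ r^-1 Gy).
    have -> : io r^-1 *: y + x0 = io r^-1 *: (y + io r *: x0).
      by rewrite scalerDr scalerA -rmorphM mulVf ?gt_eqF // rmorph1 scale1r.
    rewrite nmZ nm_emb gtr0_norm ?invr_gt0 // => h.
    have := ler_wpM2l (ltW r0) h.
    have -> : r * (c * (r^-1 * nm (y + io r *: x0)) - r^-1 * b) =
        c * nm (y + io r *: x0) - b.
      by field; rewrite gt_eqF.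
    by lra.
  + have s0 : 0 < - r by rewrite oppr_gt0.
    have := c0l _ _ (Gs _ _ (- r)^-1 Gy).
    have -> : io (- r)^-1 *: y - x0 = io (- r)^-1 *: (y + io r *: x0).
      rewrite scalerDr scalerA -rmorphM invrN mulNr mulVf ?lt_eqF //.
      by rewrite rmorphN1 scaleN1r.
    rewrite nmZ nm_emb gtr0_norm ?invr_gt0 // => h.
    have := ler_wpM2l (ltW s0) h.
    have -> : - r * ((- r)^-1 * b - c * ((- r)^-1 * nm (y + io r *: x0))) =
        b - c * nm (y + io r *: x0).
      by field; rewrite lt_eqF.
    by lra.
Qed.

(** Zorn's lemma gives a maximal dominated graph containing [G0]; by [dominated_graph_extend] its
    domain is all of [X]. *)
Lemma Hahn_Banach (G0 : set (X * R)) : dominated_graph G0 ->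
  exists u : X -> R, [/\ forall x y r, u (x + io r *: y) = u x + r * u y,
    forall x, u x <= c * nm x & forall x a, G0 (x, a) -> u x = a].
Proof.
move=> dG0.
pose T := {G : set (X * R) | dominated_graph G /\ G0 `<=` G}.
pose leT (s t : T) := `[< sval s `<=` sval t >].
have [[G [dG G0G]] Gmax] : exists t : T, forall s, leT t s -> s = t.
  apply: Zorn => [t|r s t|[s ds] [t dt]|A Atot].
  - exact/asboolP.
  - by move=> /asboolP rs /asboolP st; apply/asboolP/(subset_trans rs).
  - move=> /asboolP /= st /asboolP /= ts.
    by apply: eq_exist; apply/seteqP; split.
  (* Adjoining [G0] covers the empty chain, whose union would not contain [(0, 0)]. *)
  pose B : set T := A `|` [set exist _ G0 (conj dG0 (@subset_refl _ G0))].
  have Btot s t : B s -> B t -> sval s `<=` sval t \/ sval t `<=` sval s.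
    move=> [As|->] [At|->]; [|right|left|by left].
    - by case: (Atot _ _ As At) => /asboolP ?; [left|right].
    - exact: (svalP s).2.
    - exact: (svalP t).2.
  pose U := \bigcup_(s in B) sval s.
  have G0U : G0 `<=` U.
    move=> p Gp; exists (exist _ G0 (conj dG0 (@subset_refl _ G0))) => //.
    by right.
  have dU : dominated_graph U.
    split.
    - by apply: G0U; case: (dG0).
    - move=> x y a b r [s Bs sx] [t Bt ty].
      have [st|ts] := Btot _ _ Bs Bt.
        by exists t => //; have [_ + _] := (svalP t).1; apply=> //; exact: st.
      by exists s => //; have [_ + _] := (svalP s).1; apply=> //; exact: ts.
    - by move=> x a [s _ sx]; have [_ _] := (svalP s).1; exact.
  exists (exist _ U (conj dU G0U)) => s As; apply/asboolP => p sp.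
  by exists s => //; left.
have Gtot x : exists a, G (x, a).
  have [c0 dG1] := dominated_graph_extend x dG.
  set G1 := (X in dominated_graph X) in dG1.
  have GG1 : G `<=` G1.
    by move=> [y a] Gy; exists y, a, 0; rewrite rmorph0 scale0r mul0r !addr0.
  have : leT (exist _ G (conj dG G0G)) (exist _ G1 (conj dG1 (subset_trans G0G GG1))).
    exact/asboolP.
  move=> /Gmax [] GE; exists c0; rewrite -GE; exists 0, 0, 1.
  by case: (dG) => ? _ _; rewrite rmorph1 scale1r mul1r !add0r.
case: (dG) => Gz Gl Gd.
have Guniq x a b : G (x, a) -> G (x, b) -> a = b.
  have le y p q : G (y, p) -> G (y, q) -> p <= q.
    move=> yp yq; have /Gd := Gl _ _ _ _ (-1) yp yq.
    by rewrite rmorphN rmorph1 scaleN1r subrr nm0 mulr0 mulN1r subr_le0.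
  by move=> xa xb; apply/eqP; rewrite eq_le !(le x).
have [u uG] := choice Gtot; exists u; split.
- by move=> x y r; apply: (Guniq (x + io r *: y)) => //; exact: Gl.
- by move=> x; exact: Gd.
- by move=> x a /G0G; exact: Guniq.
Qed.

End HahnBanach.

(** The real Hahn-Banach theorem gives the constant [d^-1]; the factor 2 leaves room for a complex
    form built from two real ones. *)
Definition separation_property (X : normedModType K) :=
  forall (V : set X) (e : X) (d : R), V 0 ->
  (forall a x y, V x -> V y -> V (a *: x + y)) ->
  0 < d -> (forall v, V v -> d <= nm (e + v)) ->
  exists g : {scalar X}, [/\ forall v, V v -> g v = 0, g e = 1
    & forall x, nm (g x) <= 2 / d * nm x].

(* [re] stands for the identity or for the real part of a complex number. *)
Lemma real_separation (X : normedModType K) (re : K -> R)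
    (V : set X) (e : X) (d : R) :
  (forall a b r, re (a + io r * b) = re a + r * re b) ->
  (forall a, re a <= nm a) ->
  V 0 -> (forall a x y, V x -> V y -> V (a *: x + y)) ->
  0 < d -> (forall v, V v -> d <= nm (e + v)) ->
  exists u : X -> R, [/\ forall x y r, u (x + io r *: y) = u x + r * u y,
    forall x, `|u x| <= d^-1 * nm x & forall v k, V v -> u (v + k *: e) = re k].
Proof.
move=> re_lin re_le V0 Vl d0 dV.
have re0 : re 0 = 0 by have := re_lin 0 0 1; rewrite mulr0 addr0 mul1r; lra.
pose G0 : set (X * R) := [set p | exists v k, [/\ V v, p.1 = v + k *: e & p.2 = re k]].
have dG0 : dominated_graph d^-1 G0.
  split.
  - by exists 0, 0; rewrite scale0r addr0.
  - move=> x y a b r [v [k [Vv /= -> ->]]] [w [l [Vw /= -> ->]]].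
    exists (v + io r *: w), (k + io r * l); split=> //=.
      by rewrite addrC; apply: Vl.
    by rewrite scalerDl scalerDr scalerA addrACA.
  - move=> x a [v [k [Vv /= -> ->]]]; apply: le_trans (re_le k) _.
    have [->|k0] := eqVneq k 0.
      by rewrite nm0 mulr_ge0 ?invr_ge0 ?nm_ge0 // ltW.
    rewrite mulrC ler_pdivlMr // .
    have -> : v + k *: e = k *: (e + k^-1 *: v).
      by rewrite scalerDr scalerA divff // scale1r addrC.
    rewrite nmZ ler_wpM2l ?nm_ge0 // dV //.
    by have := Vl k^-1 _ _ Vv V0; rewrite addr0.
have di : 0 <= d^-1 by rewrite invr_ge0 ltW.
have [u [ul ub uG]] := Hahn_Banach di dG0; exists u; split=> //.
  move=> x; rewrite ler_norml ub andbT lerNl.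
  have u0 : u 0 = 0 by have := ul 0 0 1; rewrite scaler0 addr0 mul1r; lra.
  have := ul 0 x (-1); rewrite u0 rmorphN rmorph1 scaleN1r !add0r mulN1r => <-.
  by rewrite -nmN.
by move=> v k Vv; apply: uG; exists v, k.
Qed.

End RealNorm.

(** * Construction of a bounded biorthogonal sequence *)

Section BiorthogonalSequence.
Variables (R : realType) (K : numFieldType) (S : real_scalars R K).
Variable X : normedModType K.
Local Notation nrm := (nm S).

Definition totally_bounded_scalars :=
  forall B delta : R, 0 < delta ->
  exists L : seq K, forall a, nrm a <= B -> exists2 l, l \in L & nrm (a - l) <= delta.

Hypothesis sep : separation_property S X.
Hypothesis tb : totally_bounded_scalars.
Hypothesis infd : infinite_dimensional X.

(** One coefficient is peeled off at a time, which matches the way [common_kernel] adjoins a vector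
    to the list. *)
Fixpoint in_span (s : seq X) (v : X) : Prop :=
  if s is u :: s' then exists c, in_span s' (v - c *: u) else v = 0.

Lemma in_span_sum s v : in_span s v ->
  exists c : nat -> K, v = \sum_(i < size s) c i *: s`_i.
Proof.
elim: s v => [|u s IH] v /=; first by move=> ->; exists (fun=> 0); rewrite big_ord0.
move=> [c /IH[b vE]]; exists (fun i => if i is j.+1 then b j else c).
by rewrite big_ord_recl /= -vE addrC subrK.
Qed.

(** The list [s] serves the induction on [n]. If some [u] killed by the first [n] forms has
    [G n u != 0], a vector outside the span of [u :: s] is corrected by a multiple of [u] and stays
    outside the span of [s]. *)
Lemma common_kernel (G : nat -> {scalar X}) n (s : seq X) :
  exists2 v, (forall i, (i < n)%N -> G i v = 0) & ~ in_span s v.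
Proof.
elim: n s => [|n IH] s.
  have [v vN] := infd (fun i : 'I_(size s) => s`_i); exists v => // /in_span_sum[c].
  exact: (vN (fun i => c i)).
have [allz|] := pselect (forall u, (forall i, (i < n)%N -> G i u = 0) -> G n u = 0).
  have [v vz vN] := IH s; exists v => // i; rewrite ltnS leq_eqVlt => /orP[/eqP ->|/vz//].
  exact: allz.
move=> /existsNP[u /not_implyP[uz /eqP un]].
have [v vz vN] := IH (u :: s).
exists (v - (G n v / G n u) *: u) => [i|vs]; last by apply: vN; exists (G n v / G n u).
rewrite ltnS leq_eqVlt => /orP[/eqP ->|ilt]; rewrite linearB linearZ /=.
  by rewrite divfK // subrr.
by rewrite (vz i ilt) (uz i ilt) mulr0 subrr.
Qed.

Lemma finite_net (e : nat -> X) k (B delta : R) : (forall i, (i < k)%N -> nrm (e i) = 1) ->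
  0 < delta -> exists F : seq X, forall a : nat -> K,
  (forall j, (j < k)%N -> nrm (a j) <= B) ->
  exists2 f, f \in F & nrm (\sum_(j < k) a j *: e j - f) <= k%:R * delta.
Proof.
move=> e1 d0; elim: k e1 => [|k IH] e1.
  exists [:: 0] => a _; exists 0; first by rewrite inE.
  by rewrite big_ord0 subr0 nm0 mul0r.
have [F HF] := IH (fun i ik => e1 i (ltnW ik)); have [L HL] := tb B d0.
exists [seq f + l *: e k | f <- F, l <- L] => a aB.
have [f fF fa] := HF a (fun j jk => aB j (ltnW jk)).
have [l lL la] := HL (a k) (aB k (ltnSn k)).
exists (f + l *: e k); first by apply/allpairsP; exists (f, l).
rewrite big_ord_recr /= opprD addrACA -scalerBl -natr1 mulrDl mul1r.
apply: le_trans (nmD _ _ _) (lerD fa _).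
by rewrite nmZ e1 // mulr1.
Qed.

(** The condition [f != 0] stands inside the existential so that [choice] yields a family indexed by
    all vectors. *)
Lemma norming_functional (f : X) : exists g : {scalar X},
  f != 0 -> g f = 1 /\ forall x, nrm (g x) <= 2 / nrm f * nrm x.
Proof.
have [->|f0] := eqVneq f 0; first by exists \0.
have [||v ->|g [_ g1 gb]] := @sep [set 0] f (nrm f) erefl.
- by move=> a x y -> ->; rewrite scaler0 addr0.
- exact: nm_gt0.
- by rewrite addr0.
by exists g.
Qed.

(** The constant 8 is the [2 / d] of the separation property for the distance [d = 1/4]. *)
Definition biorthogonal (p : nat -> X * {scalar X}) k :=
  [/\ forall i, (i < k)%N -> nrm (p i).1 = 1,
      forall i j, (i < k)%N -> (j < k)%N -> (p i).2 (p j).1 = (i == j)%:R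
    & forall i x, (i < k)%N -> nrm ((p i).2 x) <= 8 * nrm x].

Definition extend_at (p : nat -> X * {scalar X}) k q i := if i == k then q else p i.

(* Mazur's step: if the unit vector [e] is killed by functionals norming a net of
   the ball of radius 2 of the span, then it is at distance at least 1/4 from it. *)
Lemma biorthogonal_step p k : biorthogonal p k ->
  exists q, biorthogonal (extend_at p k q) k.+1.
Proof.
move=> [p1 pg pb].
have k0 : 0 < k.+1%:R :> R by rewrite ltr0n.
have d0 : 0 < (12 * k.+1%:R)^-1 :> R by rewrite invr_gt0 mulr_gt0.
(* A combination of norm below 2 has coefficients of norm at most [8 * 2 = 16], and the chosen mesh
   keeps the total error within 1/12. *)
have [F HF] := finite_net 16 p1 d0.
have kd : k%:R * (12 * k.+1%:R)^-1 <= 12^-1 :> R.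
  by rewrite invfM mulrCA ler_piMr // ler_pdivrMr // mul1r ler_nat.
have [phi Hphi] := choice norming_functional.
pose G i := if (i < k)%N then (p i).2 else phi F`_(i - k).
have [v vz vn] := common_kernel G (k + size F) [::].
have v0 : v != 0 by apply/eqP.
pose e := emb S (nrm v)^-1 *: v.
have e1 : nrm e = 1.
  rewrite nmZ nm_emb ger0_norm ?invr_ge0 ?nm_ge0 // mulVf //.
  by rewrite gt_eqF // nm_gt0.
have ez (g : {scalar X}) : g v = 0 -> g e = 0 by move=> gv; rewrite linearZ /= gv mulr0.
have pe i : (i < k)%N -> (p i).2 e = 0.
  by move=> ik; apply: ez; have := vz i; rewrite /G ik; apply; rewrite ltn_addr.
have phie f : f \in F -> phi f e = 0.
  move=> fF; apply: ez; have := vz (k + index f F)%N.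
  rewrite /G ltn_add2l index_mem fF; have -> : (k + index f F < k)%N = false by lia.
  by rewrite addKn nth_index //; apply.
pose V : set X := [set w | exists a : nat -> K, w = \sum_(j < k) a j *: (p j).1].
have V0 : V 0.
  by exists (fun=> 0); rewrite big1 // => i _; rewrite scale0r.
have Vl a x y : V x -> V y -> V (a *: x + y).
  move=> [b ->] [c ->]; exists (fun j => a * b j + c j).
  rewrite scaler_sumr -big_split /=; apply: eq_bigr => j _.
  by rewrite scalerDl scalerA.
have dist w : V w -> 4^-1 <= nrm (e + w).
  move=> [a wE].
  have w1 : 1 - nrm w <= nrm (e + w).
    by rewrite -e1 lerBlDr -{1}(addrK w e) nmB.
  have w2 : nrm w - 1 <= nrm (e + w).
    rewrite -e1 lerBlDr; have -> : w = (e + w) - e by rewrite addrC addKr.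
    by rewrite addrCA subrr addr0 nmB.
  have [big|small] := leP 2 (nrm w); first by lra.
  have pa j : (j < k)%N -> (p j).2 w = a j.
    move=> jk; rewrite wE linear_sum /= (bigD1 (Ordinal jk)) //=.
    rewrite linearZ /= pg // eqxx mulr1 big1 ?addr0 // => i ij.
    by rewrite linearZ /= pg // (_ : _ == _ = false) ?mulr0 // eq_sym; exact: negbTE.
  have [j jk|f fF] := HF a.
    by rewrite -pa //; have := pb j w jk; lra.
  rewrite -wE => wf; have wf2 := le_trans wf kd.
  have ef : nrm f / 2 <= nrm (e + f).
    have [->|f0] := eqVneq f 0; first by rewrite nm0 mul0r nm_ge0.
    have [phi1 /(_ (e + f))] := Hphi f f0.
    rewrite linearD /= phie // add0r phi1 nm1 => h.
    have fp := nm_gt0 S f0.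
    have := ler_wpM2l (ltW fp) h; rewrite mulr1 => h2.
    have : nrm f * (2 / nrm f * nrm (e + f)) = 2 * nrm (e + f) by field; rewrite gt_eqF.
    by lra.
  (* With [t = |w|], the bounds [ef], [h1] and [h2] give [|e + w| >= t / 2 - 1/8], while [w1] gives
     [|e + w| >= 1 - t]. Twice the first plus the second yields [3 |e + w| >= 3/4]. *)
  have h1 : nrm (e + f) <= nrm (e + w) + nrm (w - f).
    have -> : e + f = (e + w) - (w - f) by rewrite opprB addrACA subrr addr0.
    exact: nmB.
  have h2 : nrm w <= nrm f + nrm (w - f).
    by have := nmD S f (w - f); rewrite addrCA subrr addr0.
  by lra.
have q0 : 0 < 4^-1 :> R by lra.
have [g [gV ge gb]] := sep V0 Vl q0 dist.
have gp i : (i < k)%N -> g (p i).1 = 0.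
  move=> ik; apply: gV; exists (fun j => (j == i)%:R).
  rewrite (bigD1 (Ordinal ik)) //= eqxx scale1r big1 ?addr0 // => j ji.
  by rewrite (_ : _ == _ = false) ?scale0r //; exact: negbTE.
have ltk i : (i < k.+1)%N -> i != k -> (i < k)%N by lia.
exists (e, g); rewrite /extend_at; split => [i ik|i j ik jk|i x ik].
- by have [//|/(ltk _ ik)/p1] := eqVneq i k.
- have [iE|nik] := eqVneq i k; have [jE|njk] := eqVneq j k => /=.
  + by rewrite ge iE jE eqxx.
  + by rewrite gp ?(ltk j) // iE eq_sym (negbTE njk).
  + by rewrite pe ?(ltk i) // jE (negbTE nik).
  + by apply: pg; apply: ltk.
- have [_|/(ltk _ ik) ilt] := eqVneq i k; last exact: pb.
  by apply: le_trans (gb x) _; rewrite invrK -natrM.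
Qed.

Lemma biorthogonal_sequence : exists (e : nat -> X) (g : nat -> {scalar X}),
  [/\ forall i, nrm (e i) = 1, forall i j, g i (e j) = (i == j)%:R
    & forall i x, nrm (g i x) <= 8 * nrm x].
Proof.
have step pk : exists q, biorthogonal pk.1 pk.2 ->
    biorthogonal (extend_at pk.1 pk.2 q) pk.2.+1.
  have [/biorthogonal_step[q qb]|nb] := pselect (biorthogonal pk.1 pk.2).
    by exists q.
  by exists (0, \0 : {scalar X}).
have [Q HQ] := choice step.
(* Stage [k] changes only entry [k], so entry [i] is final from stage [i + 1] on and the diagonal
   [P i.+1 i] is the required sequence. *)
pose P := fix P n := if n is k.+1 then extend_at (P k) k (Q (P k, k)) else
  fun=> (0, \0 : {scalar X}).
have PB k : biorthogonal (P k) k.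
  by elim: k => [|k IH]; [split|exact: (HQ (P k, k))].
have PE k i : (i < k)%N -> P k i = P i.+1 i.
  elim: k => // k IH; rewrite ltnS leq_eqVlt => /orP[/eqP -> //|ik].
  by rewrite -IH //= /extend_at ltn_eqF.
exists (fun i => (P i.+1 i).1), (fun i => (P i.+1 i).2); split => [i|i j|i x].
- by have [+ _ _] := PB i.+1; apply.
- have [_ + _] := PB (maxn i j).+1; rewrite -(PE (maxn i j).+1 i) -?(PE (maxn i j).+1 j).
  + by apply; rewrite ltnS ?leq_maxl ?leq_maxr.
  + by rewrite ltnS leq_maxr.
  + by rewrite ltnS leq_maxl.
- by have [_ _ +] := PB i.+1; apply.
Qed.

End BiorthogonalSequence.

(** * The rotation blocks and the convergence of their sum *)

Section Operator.
Variables (R : realType) (K : numFieldType) (S : real_scalars R K).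
Variable X : completeNormedModType K.
Local Notation nrm := (nm S).
Local Notation io := (emb S).
Variables (e : nat -> X) (g : nat -> {scalar X}).
Hypothesis e1 : forall i, nrm (e i) = 1.
Hypothesis ge : forall i j, g i (e j) = (i == j)%:R.
Hypothesis gb : forall i x, nrm (g i x) <= 8 * nrm x.
Variables (N : nat) (w : nat -> 'I_N.+1 -> K).
Hypothesis w1 : forall k, exists i, w k i = 1.
Hypothesis w2 : forall k i, nrm (w k i) <= 2.
Hypothesis w_dense : forall (a : 'I_N -> 'I_N.+1 -> K) (eps : R) j, 0 < eps ->
  exists2 k, (j <= k)%N & forall l, nrm (\sum_i w k i * a l i) < eps.

(* The functionals [w k] involve the first [N.+1] vectors, the rotation blocks use
   the next ones two by two. *)
Definition blkl k := (N.+1 + k.*2)%N.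
Definition blkr k := (N.+1 + k.*2.+1)%N.

Definition wform k x := \sum_i w k i * g i x.
Definition ycoordl k x := g (blkl k) x + io (gain R k) * wform k x.
Definition ycoordr k x := g (blkr k) x.
(** [movel] and [mover] are the two coordinates of [(A_k^n - 1) y_k(x)]; [moves] collects the
    partial sums of [T^n x - x]. *)
Definition movel k n x :=
  io (rot_cos R k n - 1) * ycoordl k x - io (rot_sin R k n) * ycoordr k x.
Definition mover k n x :=
  io (rot_sin R k n) * ycoordl k x + io (rot_cos R k n - 1) * ycoordr k x.
Definition move k n x := movel k n x *: e (blkl k) + mover k n x *: e (blkr k).
Definition moves n x m := \sum_(k < m) move k n x.

Lemma wform_linear k a x y : wform k (a *: x + y) = a * wform k x + wform k y.
Proof.
rewrite /wform mulr_sumr -big_split /=; apply: eq_bigr => i _.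
by rewrite linearP /= mulrDr mulrCA.
Qed.

Lemma ycoordl_linear k a x y :
  ycoordl k (a *: x + y) = a * ycoordl k x + ycoordl k y.
Proof. by rewrite /ycoordl wform_linear linearP /=; ring. Qed.

Lemma ycoordr_linear k a x y :
  ycoordr k (a *: x + y) = a * ycoordr k x + ycoordr k y.
Proof. by rewrite /ycoordr linearP. Qed.

Lemma moves_linear n m a x y :
  moves n (a *: x + y) m = a *: moves n x m + moves n y m.
Proof.
rewrite /moves scaler_sumr -big_split /=; apply: eq_bigr => k _.
rewrite /move /movel /mover ycoordl_linear ycoordr_linear.
rewrite scalerDr !scalerA addrACA -!scalerDl.
by congr (_ *: _ + _ *: _); ring.
Qed.

Lemma wform_le k x (t : R) : (forall i : 'I_N.+1, nrm (g i x) <= t) ->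
  nrm (wform k x) <= N.+1%:R * (2 * t).
Proof.
move=> gt; apply: le_trans (nm_sum _ _ _ _) _.
rewrite -[N.+1 in leRHS]card_ord mulr_natl -sumr_const ler_sum // => i _.
by rewrite nmM ler_pM ?nm_ge0.
Qed.

Lemma move_le k n x :
  nrm (move k n x) <= 2 * chord R k n * (nrm (ycoordl k x) + nrm (ycoordr k x)).
Proof.
apply: le_trans (nmD _ _ _) _; rewrite !nmZ !e1 !mulr1.
have hc := norm_rot_cosB1_le R k n; have hs := norm_rot_sin_le R k n.
have l : nrm (movel k n x) <= chord R k n * (nrm (ycoordl k x) + nrm (ycoordr k x)).
  apply: le_trans (nmB _ _ _) _; rewrite !nmM !nm_emb mulrDr.
  by rewrite lerD // ler_wpM2r ?nm_ge0.
have r : nrm (mover k n x) <= chord R k n * (nrm (ycoordl k x) + nrm (ycoordr k x)).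
  apply: le_trans (nmD _ _ _) _; rewrite !nmM !nm_emb mulrDr.
  by rewrite lerD // ler_wpM2r ?nm_ge0.
by rewrite -mulrA mulr_natl mulr2n lerD.
Qed.

Lemma ycoords_le k x : nrm (ycoordl k x) + nrm (ycoordr k x) <=
  16 * nrm x + gain R k * nrm (wform k x).
Proof.
have := gb (blkl k) x; have := gb (blkr k) x.
have : nrm (ycoordl k x) <= nrm (g (blkl k) x) + gain R k * nrm (wform k x).
  apply: le_trans (nmD _ _ _) _; rewrite nmM nm_emb ger0_norm //.
  exact/ltW/gain_gt0.
by rewrite /ycoordr; lra.
Qed.

Lemma move_dvd k n x : (period k.+1 %| n)%N -> move k n x = 0.
Proof.
move=> /(chord_dvd R) ch0; apply/(nm_eq0 (S:=S))/eqP.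
by rewrite eq_le nm_ge0 andbT; have := move_le k n x; rewrite ch0 mulr0 mul0r.
Qed.

(** In [move_period_le], [512 = 32 * 16] comes from the basis coordinates and [256 = 2 * 8 * 16]
    from [wform]. *)
Definition bnd : R := 512 + 256 * N.+1%:R.

Lemma bnd_ge0 : 0 <= bnd.
Proof. by rewrite addr_ge0 // mulr_ge0. Qed.

Lemma move_period_le k n x :
  nrm (move k n x) <= bnd * n%:R * nrm x * (period k)%:R^-1.
Proof.
apply: le_trans (move_le _ _ _) _.
apply: le_trans (ler_wpM2l _ (ycoords_le _ _)) _.
  by rewrite mulr_ge0 ?chord_ge0.
have wx : nrm (wform k x) <= N.+1%:R * (2 * (8 * nrm x)) by exact: wform_le.
have c0 := chord_ge0 R k n; have g0 := gain_gt0 R k; have x0 := nm_ge0 S x.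
set p := (period k)%:R^-1.
have h1 : chord R k n <= 16 * n%:R * p := chord_le_period R k n.
have h2 : chord R k n * gain R k <= 8 * n%:R * p := chord_gain_le R k n.
have h3 : chord R k n * nrm x <= 16 * n%:R * p * nrm x by rewrite ler_wpM2r.
have h4 : chord R k n * gain R k * nrm (wform k x) <=
    8 * n%:R * p * (N.+1%:R * (2 * (8 * nrm x))).
  by apply: ler_pM => //; rewrite ?nm_ge0 // mulr_ge0 // ltW.
have -> : bnd * n%:R * nrm x * p = 32 * (16 * n%:R * p * nrm x) +
    2 * (8 * n%:R * p * (N.+1%:R * (2 * (8 * nrm x)))) by rewrite /bnd; ring.
have -> : 2 * chord R k n * (16 * nrm x + gain R k * nrm (wform k x)) =
   32 * (chord R k n * nrm x) + 2 * (chord R k n * gain R k * nrm (wform k x)) by ring.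
by lra.
Qed.

(** By [period_inv_step], this bounds the sum over all blocks from [m] on of the estimates of
    [move_period_le]. *)
Definition tail n (x : X) m : R := 2 * (bnd * n%:R * nrm x) / (period m)%:R.

Lemma tail_cvg0 (c : R) : 0 <= c -> forall eps, 0 < eps ->
  exists m0, forall m, (m0 <= m)%N -> c / (period m)%:R < eps.
Proof.
move=> c0 eps eps0; exists (Num.bound (c / eps)) => m mm.
have p0 : 0 < (period m)%:R :> R by rewrite ltr0n period_gt0.
rewrite ltr_pdivrMr // mulrC -ltr_pdivrMr //.
apply: lt_le_trans (archi_boundP _) _; first by rewrite divr_ge0 // ltW.
by rewrite ler_nat (leq_trans mm) // ltnW // period_ge.
Qed.

Lemma tail_scale_ge0 n (x : X) : 0 <= 2 * (bnd * n%:R * nrm x).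
Proof. by rewrite !mulr_ge0 ?nm_ge0 // bnd_ge0. Qed.

Lemma moves_cvg n x : exists l, forall m, nrm (l - moves n x m) <= tail n x m.
Proof.
apply: nm_telescope_cvg => [eps /(tail_cvg0 (tail_scale_ge0 n x))[m mE]|m m' mm'].
  by exists m; exact: mE.
(* The induction needs this sharper bound: block [m'] is paid for by the drop of [tail] from [m'] to
   [m'.+1]. *)
suff : nrm (moves n x m' - moves n x m) <= tail n x m - tail n x m'.
  move/le_trans; apply; rewrite gerBl divr_ge0 //.
  exact: tail_scale_ge0.
elim: m' mm' => [|m' IH].
  by rewrite leqn0 => /eqP ->; rewrite !subrr nm0.
rewrite leq_eqVlt => /orP[/eqP ->|]; first by rewrite !subrr nm0.
rewrite ltnS => /IH h; rewrite /moves big_ord_recr /= addrAC.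
apply: le_trans (nmD _ _ _) _.
have -> : tail n x m - tail n x m'.+1 =
  (tail n x m - tail n x m') + (tail n x m' - tail n x m'.+1) by ring.
apply: lerD h _; apply: le_trans (move_period_le _ _ _) _.
have b0 : 0 <= bnd * n%:R * nrm x by rewrite !mulr_ge0 ?nm_ge0 // bnd_ge0.
have := ler_wpM2l b0 (period_inv_step R m').
by rewrite /tail => /le_trans; apply; rewrite le_eqVlt; apply/orP; left; apply/eqP; ring.
Qed.

Lemma cvg0_eq0 (V : normedZmodType K) (z : V) (c : R) m0 : 0 <= c ->
  (forall m, (m0 <= m)%N -> nrm z <= c / (period m)%:R) -> z = 0.
Proof.
move=> c0 zc; apply/(nm_eq0 (S:=S))/eqP; rewrite eq_le nm_ge0 andbT leNgt.
apply/negP => z0; have [m1 /(_ (maxn m0 m1) (leq_maxr _ _))] := tail_cvg0 c0 z0.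
by rewrite ltNge zc // leq_maxl.
Qed.

(** * The operator, its iterates, recurrence and its failure *)

Section Limit.
Variable L : nat -> X -> X.
Hypothesis LP : forall n x m, nrm (L n x - moves n x m) <= tail n x m.

(** Identities pass to the limit through this lemma: [c] may be any constant, so that combinations
    of several limits qualify. *)
Lemma limit_unique n x l c : 0 <= c ->
  (forall m, nrm (l - moves n x m) <= c / (period m)%:R) -> l = L n x.
Proof.
move=> c0 h; apply/eqP; rewrite -subr_eq0; apply/eqP.
apply: (@cvg0_eq0 _ _ (c + 2 * (bnd * n%:R * nrm x)) 0) => [|m _].
  by rewrite addr_ge0 // tail_scale_ge0.
have -> : l - L n x = (l - moves n x m) - (L n x - moves n x m).
  by rewrite opprB addrA subrK.
by apply: le_trans (nmB _ _ _) _; rewrite mulrDl lerD.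
Qed.

Lemma limit_form j n x r m0 :
  (forall m, (m0 <= m)%N -> g j (moves n x m) = r) -> g j (L n x) = r.
Proof.
move=> h; apply/eqP; rewrite -subr_eq0; apply/eqP.
apply: (@cvg0_eq0 _ _ (8 * (2 * (bnd * n%:R * nrm x))) m0) => [|m mm].
  by rewrite mulr_ge0 // tail_scale_ge0.
rewrite -(h m mm) -linearB /=; apply: le_trans (gb _ _) _.
by rewrite -[leRHS]mulrA ler_wpM2l.
Qed.

Lemma form_moves j n x m : g j (moves n x m) =
  \sum_(k < m) (movel k n x * (j == blkl k)%:R + mover k n x * (j == blkr k)%:R).
Proof.
rewrite linear_sum; apply: eq_bigr => k _.
by rewrite linearD !linearZ /= !ge.
Qed.

Lemma form_limit_low (j : 'I_N.+1) n x : g j (L n x) = 0.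
Proof.
apply: (@limit_form _ _ _ _ 0) => m _; rewrite form_moves big1 // => k _.
have jN := ltn_ord j.
have -> : (j == blkl k :> nat) = false by apply/negbTE; rewrite /blkl; lia.
have -> : (j == blkr k :> nat) = false by apply/negbTE; rewrite /blkr; lia.
by rewrite !mulr0 addr0.
Qed.

Lemma blk_eq k k' : [/\ (blkl k == blkl k') = (k == k'),
  (blkr k == blkr k') = (k == k'), (blkl k == blkr k') = false
  & (blkr k == blkl k') = false].
Proof. by rewrite /blkl /blkr; split; lia. Qed.

Lemma form_limit_l k n x : g (blkl k) (L n x) = movel k n x.
Proof.
apply: (@limit_form _ _ _ _ k.+1) => m km; rewrite form_moves.
rewrite (bigD1 (Ordinal km)) //= big1 => [|i ik].
  by have [-> _ -> _] := blk_eq k k; rewrite eqxx mulr1 mulr0 !addr0.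
have [-> _ -> _] := blk_eq k i.
by rewrite eq_sym (_ : _ == _ = false) ?mulr0 ?addr0 //; exact: negbTE.
Qed.

Lemma form_limit_r k n x : g (blkr k) (L n x) = mover k n x.
Proof.
apply: (@limit_form _ _ _ _ k.+1) => m km; rewrite form_moves.
rewrite (bigD1 (Ordinal km)) //= big1 => [|i ik].
  by have [_ -> _ ->] := blk_eq k k; rewrite eqxx mulr1 mulr0 addr0 add0r.
have [_ -> _ ->] := blk_eq k i.
by rewrite eq_sym (_ : _ == _ = false) ?mulr0 ?addr0 //; exact: negbTE.
Qed.

(** The blocks avoid the first [N.+1] basis vectors, so [wform k] is invariant under adding [L n x]
    and [y_k] is merely rotated. *)
Lemma wform_limit k n x : wform k (L n x) = 0.
Proof. by rewrite /wform big1 // => i _; rewrite form_limit_low mulr0. Qed.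

Lemma ycoordl_limit k n x : ycoordl k (x + L n x) = ycoordl k x + movel k n x.
Proof.
have := ycoordl_linear k 1 (L n x) x; rewrite scale1r mul1r addrC => ->.
by rewrite {1}/ycoordl wform_limit mulr0 addr0 form_limit_l addrC.
Qed.

Lemma ycoordr_limit k n x : ycoordr k (x + L n x) = ycoordr k x + mover k n x.
Proof. by rewrite /ycoordr linearD /= form_limit_r. Qed.

(** Since [y_k(x + L n x) = A_k^n y_k(x)], this is [A^(n+1) - 1 = (A^n - 1) + (A - 1) A^n]. *)
Lemma move_add k n x : move k n.+1 x = move k n x + move k 1 (x + L n x).
Proof.
rewrite /move addrACA -!scalerDl; congr (_ *: _ + _ *: _).
all: rewrite /movel /mover ycoordl_limit ycoordr_limit /movel /mover.
all: rewrite -[n.+1]addn1 rot_cosD rot_sinD !(rmorphB, rmorphD, rmorphM, rmorph1).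
all: by ring.
Qed.

Definition op x := x + L 1 x.

Lemma op_linear : linear op.
Proof.
move=> a x y; rewrite /op.
suff <- : a *: L 1 x + L 1 y = L 1 (a *: x + y) by rewrite scalerDr addrACA.
apply: (@limit_unique _ _ _ (nrm a * (2 * (bnd * 1%:R * nrm x)) +
    2 * (bnd * 1%:R * nrm y))) => [|m].
  by rewrite addr_ge0 ?mulr_ge0 ?nm_ge0 ?tail_scale_ge0 // bnd_ge0.
rewrite moves_linear opprD addrACA -scalerBr.
apply: le_trans (nmD _ _ _) _; rewrite nmZ mulrDl lerD ?LP //.
by rewrite -[leRHS]mulrA ler_wpM2l ?nm_ge0 // LP.
Qed.

Lemma limit_bound n x : nrm (L n x) <= 2 * (bnd * n%:R * nrm x).
Proof.
have := LP n x 0; rewrite /moves big_ord0 subr0 /tail period0.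
by rewrite divr1.
Qed.

Lemma op_bounded x : nrm (op x) <= (1 + 2 * bnd) * nrm x.
Proof.
apply: le_trans (nmD _ _ _) _; have := limit_bound 1 x; rewrite mulr1.
by lra.
Qed.

Lemma iter_op n x : iter n op x = x + L n x.
Proof.
elim: n => [|n IH].
  suff <- : 0 = L 0 x by rewrite addr0.
  apply: (@limit_unique _ _ _ 0) => // m; rewrite sub0r nmN /moves big1 ?nm0 ?mul0r //.
  by move=> k _; apply: move_dvd; rewrite dvdn0.
rewrite iterS IH /op -addrA; congr (_ + _).
apply: (@limit_unique _ _ _ (2 * (bnd * n%:R * nrm x) +
    2 * (bnd * 1%:R * nrm (x + L n x)))) => [|m].
  by rewrite addr_ge0 ?tail_scale_ge0.
have -> : moves n.+1 x m = moves n x m + moves 1 (x + L n x) m.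
  by rewrite /moves -big_split; apply: eq_bigr => k _; exact: move_add.
by rewrite opprD addrACA mulrDl; apply: le_trans (nmD _ _ _) (lerD _ _); exact: LP.
Qed.

Lemma op_recurrent (x : 'I_N -> X) (eps : R) : 0 < eps ->
  exists n, forall l, nrm (iter n.+1 op (x l) - x l) < eps.
Proof.
move=> eps0.
pose B := \sum_l nrm (x l); have B0 : 0 <= B by apply: sumr_ge0 => *; exact: nm_ge0.
have xB l : nrm (x l) <= B.
  by rewrite /B (bigD1 l) //= lerDl sumr_ge0 // => *; exact: nm_ge0.
(* At time [period j], the basis coordinates of block [j] contribute [256 = 2 * 16 * 8] and the
   later blocks [2 * bnd], both over [j + 4]. The remaining term [2 |wform|] stays below
   [eps / 4]. *)
pose c := (256 + 2 * bnd) * B.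
have c0 : 0 <= c by rewrite mulr_ge0 // addr_ge0 // mulr_ge0 // bnd_ge0.
have [j jk jw] := @w_dense (fun l i => g i (x l)) (eps / 8) (Num.bound (c / (eps / 2)))
  (divr_gt0 eps0 (ltr0Sn _ _)).
exists (period j).-1 => l; rewrite prednK ?period_gt0 // iter_op addrAC subrr add0r.
have p0 : 0 < (period j)%:R :> R by rewrite ltr0n period_gt0.
have k0 : 0 < (j + 4)%N%:R :> R by rewrite ltr0n addnC.
have h1 : c / (j + 4)%N%:R < eps / 2.
  rewrite ltr_pdivrMr // mulrC -ltr_pdivrMr ?divr_gt0 //.
  apply: lt_le_trans (archi_boundP _) _; first by rewrite divr_ge0 // divr_ge0 // ltW.
  by rewrite ler_nat (leq_trans jk) // leq_addr.
have := LP (period j) (x l) j.+1.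
rewrite /moves big_ord_recr /= big1 => [|i _]; last first.
  by apply: move_dvd; apply: dvdn_period.
rewrite add0r /tail => h2.
have h3 : 2 * (bnd * (period j)%:R * nrm (x l)) / (period j.+1)%:R =
    2 * bnd * nrm (x l) / (j + 4)%N%:R.
  rewrite periodS natrM; field.
  by rewrite -natrD !gt_eqF.
have h4 : nrm (move j (period j) (x l)) <=
   256 * nrm (x l) / (j + 4)%N%:R + 2 * nrm (wform j (x l)).
  apply: le_trans (move_le _ _ _) _.
  have cp := chord_ge0 R j (period j).
  apply: le_trans (ler_wpM2l _ (ycoords_le _ _)) _; first by rewrite mulr_ge0.
  rewrite mulrDr lerD //; last by rewrite mulrA -(mulrA 2) chord_gain mulr1.
  have := ler_wpM2r (nm_ge0 S (x l)) (chord_period_le R j).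
  have -> : 256 * nrm (x l) / (j + 4)%N%:R = 32 * (8 / (j + 4)%N%:R * nrm (x l)) by ring.
  by lra.
have h5 : nrm (wform j (x l)) < eps / 8 := jw l.
have h6 : (256 + 2 * bnd) * nrm (x l) / (j + 4)%N%:R <= c / (j + 4)%N%:R.
  apply: ler_wpM2r; first by rewrite invr_ge0 ltW.
  by apply: ler_wpM2l => //; rewrite addr_ge0 // mulr_ge0 // bnd_ge0.
have -> : L (period j) (x l) = move j (period j) (x l) +
   (L (period j) (x l) - move j (period j) (x l)) by rewrite addrCA subrr addr0.
apply: le_lt_trans (nmD _ _ _) _; rewrite h3 in h2.
have : (256 + 2 * bnd) * nrm (x l) / (j + 4)%N%:R =
   256 * nrm (x l) / (j + 4)%N%:R + 2 * bnd * nrm (x l) / (j + 4)%N%:R by ring.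
by lra.
Qed.

(** The transpose of [A_k^n - 1] inverts it up to the factor [chord^2] and so recovers [ycoordl]
    from two coordinates of [T^n x - x], each at most 8 times its norm. *)
Lemma move_lower k n x :
  chord R k n * nrm (ycoordl k x) <= 16 * nrm (iter n op x - x).
Proof.
rewrite iter_op addrAC subrr add0r.
set u := L n x.
have hl : nrm (movel k n x) <= 8 * nrm u by rewrite -form_limit_l.
have hr : nrm (mover k n x) <= 8 * nrm u by rewrite -form_limit_r.
have [c0|c0] := eqVneq (chord R k n) 0; first by rewrite c0 mul0r mulr_ge0 ?nm_ge0.
have cp : 0 < chord R k n by rewrite lt_def c0 chord_ge0.
have E : io (rot_cos R k n - 1) * movel k n x + io (rot_sin R k n) * mover k n x =
    io (chord R k n ^+ 2) * ycoordl k x.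
  rewrite -rot_chord_sqr /movel /mover !(rmorphB, rmorphD, rmorphXn, rmorph1).
  by ring.
have : nrm (io (chord R k n ^+ 2) * ycoordl k x) <= chord R k n * (16 * nrm u).
  rewrite -E; apply: le_trans (nmD _ _ _) _; rewrite !nmM !nm_emb.
  have := ler_pM (normr_ge0 _) (nm_ge0 S (movel k n x)) (norm_rot_cosB1_le R k n) hl.
  have := ler_pM (normr_ge0 _) (nm_ge0 S (mover k n x)) (norm_rot_sin_le R k n) hr.
  by lra.
by rewrite nmM nm_emb ger0_norm ?sqr_ge0 // expr2 -mulrA ler_pM2l.
Qed.

(* If [x i] is within [gap] of [e i] and the [i]-th weight of [w k] is 1, then
   [wform k (x i)] is within 1/32 of 1. *)
Definition gap : R := (64 * N.+1%:R)^-1 / 8.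

(** For the block [k] given by [period_block], [chord * gain >= 1], and [i] is an index where [w k]
    has weight 1. As [k], and with it [i], varies with the time, the whole family of [N.+1] vectors
    is involved. *)
Lemma op_not_recurrent (x : 'I_N.+1 -> X) : (forall i, nrm (x i - e i) < gap) ->
  forall n, exists i, 64^-1 <= nrm (iter n.+1 op (x i) - x i).
Proof.
move=> xe n.
have [k kn kn'] := period_block (ltn0Sn n).
have [i wi] := w1 k; exists i.
have n1 : 1 <= N.+1%:R :> R by rewrite ler1n.
have gapN : N.+1%:R * gap = 512^-1.
  by move: n1; rewrite /gap; set t := _%:R => n1; field; rewrite gt_eqF //; lra.
have gap0 : 0 < gap by rewrite /gap divr_gt0 // invr_gt0 mulr_gt0 // ltr0n.
have gapl : gap <= 512^-1 by rewrite -gapN ler_peMl // ltW.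
have gxi j : nrm (g j (x i - e i)) <= 8 * gap.
  by apply: le_trans (gb _ _) _; rewrite ler_pM2l // ltW.
have we : wform k (e i) = 1.
  rewrite /wform (bigD1 i) //= ge eqxx mulr1 big1 ?addr0 // => j ji.
  by rewrite ge (_ : _ == _ = false) ?mulr0 //; exact: negbTE.
have wx : 1 - 32^-1 <= nrm (wform k (x i)).
  have : nrm (wform k (x i - e i)) <= N.+1%:R * (2 * (8 * gap)) by exact: wform_le.
  have -> : N.+1%:R * (2 * (8 * gap)) = 16 * (N.+1%:R * gap) by ring.
  rewrite gapN => h.
  have E : wform k (x i) = 1 + wform k (x i - e i).
    have := wform_linear k 1 (x i - e i) (e i).
    by rewrite scale1r subrK mul1r we addrC.
  have := nmB S (wform k (x i)) (wform k (x i - e i)).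
  by rewrite {1}E addrK nm1; lra.
have gx : nrm (g (blkl k) (x i)) <= 64^-1.
  have -> : g (blkl k) (x i) = g (blkl k) (x i - e i).
    rewrite linearB /= ge (_ : _ == _ = false) ?subr0 //.
    by have := ltn_ord i; rewrite /blkl; lia.
  by have := gxi (blkl k); lra.
have g0 := gain_ge R k.
(* This is [gain * 31/32 - 1/64 >= gain / 2], which holds because [gain >= 1/2]. *)
have yx : gain R k / 2 <= nrm (ycoordl k (x i)).
  have := nmB S (ycoordl k (x i)) (g (blkl k) (x i)).
  rewrite {1}/ycoordl addrAC subrr add0r nmM nm_emb ger0_norm; last by lra.
  by nra.
have := move_lower k n.+1 (x i).
have := chord_gain_ge1 R kn kn'.
have := ler_wpM2l (chord_ge0 R k n.+1) yx.
rewrite mulrA; lra.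
Qed.

End Limit.

Lemma operator_exists : exists T : {linear X -> X}, [/\
  exists c, forall x, nrm (T x) <= c * nrm x,
  forall (x : 'I_N -> X) (eps : R), 0 < eps ->
    exists n, forall l, nrm (iter n.+1 T (x l) - x l) < eps
  & exists (z : 'I_N.+1 -> X) (eta : R), 0 < eta /\
    forall x, (forall i, nrm (x i - z i) < eta) ->
    forall n, exists i, eta <= nrm (iter n.+1 T (x i) - x i)].
Proof.
have [L LP] : exists L : nat -> X -> X,
    forall n x m, nrm (L n x - moves n x m) <= tail n x m.
  have Ln n : exists l, forall x m, nrm (l x - moves n x m) <= tail n x m.
    by have [l lP] := choice (moves_cvg n); exists l.
  by have [L LP] := choice Ln; exists L.
pose lin := GRing.isLinear.Build K X X *:%R (op L) (op_linear LP).
pose T : {linear X -> X} := HB.pack (op L) lin.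
exists T; split.
- by exists (1 + 2 * bnd) => x; exact: op_bounded.
- by move=> x eps eps0; exact: op_recurrent.
have gap0 : 0 < gap by rewrite /gap divr_gt0 // invr_gt0 mulr_gt0 // ltr0n.
have gap1 : gap <= 64^-1.
  have n1 : 1 <= N.+1%:R :> R by rewrite ler1n.
  have : (64 * N.+1%:R)^-1 <= 64^-1 :> R.
    by rewrite lef_pV2 ?posrE ?mulr_gt0 ?ltr0n //; lra.
  by move: gap0; rewrite /gap; move: (_^-1) => t; lra.
(* As [gap <= 1/64], the same number serves as radius and as lower bound. *)
exists (fun i => e i), gap; split=> // x xe n.
have [i hi] := op_not_recurrent LP xe n.
by exists i; apply: le_trans hi.
Qed.

End Operator.

(** * Weights dense among the normalised combinations *)

Lemma injective_unbounded (f : nat -> nat) j : injective f -> exists i, (j <= f i)%N.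
Proof.
move=> fi; apply: contrapT => /forallNP h.
have : uniq [seq f i | i <- iota 0 j.+1] by rewrite map_inj_uniq ?iota_uniq.
move/uniq_leq_size => /(_ (iota 0 j)); rewrite size_map !size_iota ltnn => H.
suff : false by []; apply: H => _ /mapP[i _ ->].
by rewrite mem_iota add0n /=; have /negP := h i; rewrite -ltnNge.
Qed.

Lemma left_kernel (K : fieldType) m n (A : 'M[K]_(m, n)) : (n < m)%N ->
  exists2 v : 'rV_m, v != 0 & v *m A = 0.
Proof.
move=> nm; exists (nz_row (kermx A)); last exact/sub_kermxP/nz_row_sub.
by rewrite nz_row_eq0 -mxrank_eq0 mxrank_ker -lt0n subn_gt0
  (leq_ltn_trans (rank_leq_col A)).
Qed.

Section Weights.
Variables (R : realType) (K : numFieldType) (S : real_scalars R K) (N : nat).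
Local Notation nrm := (nm S).
Variable d : nat -> K.
Hypothesis d_dense : forall a eps, 0 < eps -> exists n, nrm (d n - a) < eps.

(** [N] equations in [N.+1] unknowns have a nonzero solution, which is divided by an entry of
    largest norm. *)
Lemma normalized_kernel (a : 'I_N -> 'I_N.+1 -> K) :
  exists (v : 'I_N.+1 -> K) i0, [/\ v i0 = 1, forall i, nrm (v i) <= 1
    & forall l, \sum_i v i * a l i = 0].
Proof.
have [v v0 vA] := left_kernel (\matrix_(i < N.+1, l < N) a l i) (ltnSn N).
pose i0 := [arg max_(i > ord0) nrm (v 0 i)]%O.
have i0max i : nrm (v 0 i) <= nrm (v 0 i0).
  by rewrite /i0; case: arg_maxP => // j _; apply.
have vi0 : v 0 i0 != 0.
  apply: contraNneq v0 => vz; apply/eqP/rowP => i; rewrite mxE.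
  apply/(nm_eq0 (S:=S))/eqP; rewrite eq_le nm_ge0 andbT.
  by have := i0max i; rewrite vz nm0.
exists (fun i => v 0 i / v 0 i0), i0; split=> [|i|l].
- by rewrite divff.
- by rewrite nmM nmV ler_pdivrMr ?nm_gt0 // mul1r.
have /rowP/(_ l) := vA; rewrite !mxE => E.
have {}E : \sum_i v 0 i * a l i = 0.
  by rewrite -[RHS]E; apply: eq_bigr => i _; rewrite mxE.
under eq_bigr do rewrite mulrAC.
by rewrite -mulr_suml E mul0r.
Qed.

Definition weight_code : countType := ('I_N.+1 * {ffun 'I_N.+1 -> nat})%type.

(** The first component of a code is a position of the weight 1. Replacing values of norm above 2 by
    0 makes every code admissible. *)
Definition decode (c : weight_code) (i : 'I_N.+1) : K :=
  if i == c.1 then 1 else if nrm (d (c.2 i)) <= 2 then d (c.2 i) else 0.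

(* Pairing the codes with a dummy integer makes each of them occur infinitely often. *)
Definition weight k : 'I_N.+1 -> K :=
  decode (if (unpickle k : option (nat * weight_code)) is Some (_, c) then c
          else (ord0, [ffun=> 0%N])).

Lemma weight1 k : exists i, weight k i = 1.
Proof. by rewrite /weight; set c := (c in decode c); exists c.1; rewrite /decode eqxx. Qed.

Lemma weight_le2 k i : nrm (weight k i) <= 2.
Proof.
rewrite /weight /decode; case: ifP => _; first by rewrite nm1; lra.
by case: ifP => // _; rewrite nm0.
Qed.

Lemma weight_dense (a : 'I_N -> 'I_N.+1 -> K) (eps : R) j : 0 < eps ->
  exists2 k, (j <= k)%N & forall l, nrm (\sum_i weight k i * a l i) < eps.
Proof.
move=> eps0; have [v [i0 [vi0 v1 va]]] := normalized_kernel a.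
pose A := \sum_l \sum_i nrm (a l i).
have A0 : 0 <= A by apply: sumr_ge0 => l _; apply: sumr_ge0 => i _; exact: nm_ge0.
(* The bound 1 keeps approximations of entries of norm at most 1 below the cut-off 2 of [decode];
   the other bound gives [del * A < eps], also when [A = 0]. *)
pose del := Num.min 1 (eps / (A + 1)).
have del0 : 0 < del by rewrite lt_min ltr01 divr_gt0 //; lra.
have del1 : del <= 1 by rewrite ge_min lexx.
have delA : del * A < eps.
  have : del <= eps / (A + 1) by rewrite ge_min lexx orbT.
  have A1 : 0 < A + 1 by lra.
  by rewrite ler_pdivlMr //; nra.
have [c cP] := choice (fun i => d_dense (v i) del0).
pose code : weight_code := (i0, [ffun i => c i]).
have wcode i : nrm (decode code i - v i) <= del.
  rewrite /decode /=; have [->|_] := eqVneq i i0.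
    by rewrite vi0 subrr nm0 ltW.
  rewrite ffunE; case: ifP => [_|/negP[]]; first exact: ltW.
  rewrite -(subrK (v i) (d (c i))); apply: le_trans (nmD _ _ _) _.
  by have := cP i; have := v1 i; lra.
have pinj : injective (fun n : nat => pickle (n, code)).
  by move=> m n /(pcan_inj pickleK) [].
have [n jn] := injective_unbounded j pinj.
exists (pickle (n, code)) => // l; rewrite /weight pickleK.
have -> : \sum_i decode code i * a l i = \sum_i (decode code i - v i) * a l i.
  under [RHS]eq_bigr do rewrite mulrBl.
  by rewrite sumrB va subr0.
apply: le_lt_trans (nm_sum _ _ _ _) _; apply: le_lt_trans delA.
rewrite /A (bigD1 l) //= mulrDr mulr_sumr -[leLHS]addr0 lerD //.
  by apply: ler_sum => i _; rewrite nmM ler_wpM2r ?nm_ge0.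
rewrite mulr_ge0 ?(ltW del0) //.
by apply: sumr_ge0 => m _; apply: sumr_ge0 => i _; exact: nm_ge0.
Qed.

End Weights.

(** * From norm estimates to the topology of the direct sum *)

Lemma ptws_cvg (I : Type) (V : topologicalType) (F : set_system {ptws I -> V})
    (f : {ptws I -> V}) : Filter F ->
  (forall i, (fun h : {ptws I -> V} => h i) @ F --> f i) -> F --> f.
Proof.
move=> FF h; apply/cvg_sup => i U [? /= [[W oW <-]]] /= Wf /filterS; apply.
by apply: h; exact: open_nbhs_nbhs.
Qed.

Lemma iter_dsum_op (X : topologicalType) (N : nat) (T : X -> X) n
    (x : dsum_space X N) i : iter n (dsum_op N T) x i = iter n T (x i).
Proof. by elim: n => // n IH; rewrite !iterS -IH. Qed.

Section Transfer.
Variables (R : realType) (K : numFieldType) (S : real_scalars R K).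
Variable X : completeNormedModType K.
Local Notation nrm := (nm S).

Lemma dense_sequence : separable X ->
  exists d : nat -> X, forall x eps, 0 < eps -> exists n, nrm (d n - x) < eps.
Proof.
move=> [D [/countable_injP[f finj] Dd]].
have sel n : exists x, (exists2 y, D y & f y = n) -> D x /\ f x = n.
  have [[y Dy fy]|h] := pselect (exists2 y, D y & f y = n); first by exists y.
  by exists 0.
have [d dP] := choice sel; exists d => x eps eps0.
have : closure D x by rewrite Dd.
move=> /(_ [set y | nrm (x - y) < eps]) [|y [Dy /= yx]].
  by apply/(nbhs_nmP S); exists eps.
exists (f y); have [|Dd' fd] := dP (f y); first by exists y.
by rewrite (finj _ _ _ _ fd) ?inE // nmBC.
Qed.

Lemma bounded_continuous (T : {linear X -> X}) (c : R) :
  (forall x, nrm (T x) <= c * nrm x) -> continuous T.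
Proof.
move=> Tc x A /(nbhs_nmP S)[eps eps0 eA].
have c0 : 0 < `|c| + 1 by rewrite ltr_wpDl.
apply/(nbhs_nmP S); exists (eps / (`|c| + 1)); first exact: divr_gt0.
move=> y xy; apply: eA; rewrite -linearB /=.
apply: le_lt_trans (Tc _) _; move: xy; rewrite ltr_pdivlMr //.
by have := nm_ge0 S (x - y); have := ler_norm c; nra.
Qed.

Lemma nbhs_dsum N (x : dsum_space X N) (eps : R) : 0 < eps ->
  nbhs x [set y : dsum_space X N | forall i, nrm (y i - x i) < eps].
Proof.
move=> eps0.
apply: (@filter_forall (dsum_space X N) 'I_N
  (fun i => [set y : dsum_space X N | nrm (y i - x i) < eps]) (nbhs x) _) => i.
have := @proj_continuous _ (fun _ : 'I_N => X : topologicalType) i x.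
move=> /(_ [set y | nrm (y - x i) < eps]); apply.
by apply/(nbhs_nmP S); exists eps => // y; rewrite nmBC.
Qed.

Lemma recurrence_gap_of_scalars (N : nat) : separation_property S X ->
  totally_bounded_scalars S -> separable X -> infinite_dimensional X ->
  recurrence_gap X N.
Proof.
move=> sep tb sX infd.
have [e [g [e1 ge gb]]] := biorthogonal_sequence sep tb infd.
have [d0 d0P] := dense_sequence sX.
(* A dense sequence of scalars is the image under [g 0] of one in [X], since
   [g 0 (a *: e 0) = a]. *)
have dK a eps : 0 < eps -> exists n, nrm (g 0%N (d0 n) - a) < eps.
  move=> eps0; have [n dn] := d0P (a *: e 0%N) _ (divr_gt0 eps0 (ltr0Sn R 7)).
  exists n; have -> : g 0%N (d0 n) - a = g 0%N (d0 n - a *: e 0%N).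
    by rewrite linearB linearZ /= ge mulr1.
  by apply: le_lt_trans (gb _ _) _; rewrite mulrC -ltr_pdivlMr.
have [T [[c Tc] Trec [z [eta [eta0 Tz]]]]] :=
  operator_exists e1 ge gb (@weight1 _ _ S N _) (@weight_le2 _ _ S N _) (weight_dense dK).
exists T; split; first exact: bounded_continuous Tc.
split.
  apply/seteqP; split=> // x _ B xB.
  have pos n : 0 < n.+1%:R^-1 :> R by rewrite invr_gt0.
  (* Return times with error below [1 / (j + 1)] make the iterates converge coordinatewise, hence in
     the product topology. *)
  have [n nP] := choice (fun j => Trec x _ (pos j)).
  have cv : (fun j => iter (n j).+1 (dsum_op N T) x) @ \oo --> (x : {ptws 'I_N -> X}).
    apply: ptws_cvg => i A /(nbhs_nmP S)[eps eps0 eA].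
    exists (Num.bound eps^-1) => // j /= bj; apply: eA.
    rewrite -[X in _ - X]/(iter (n j).+1 (dsum_op N T) x i) iter_dsum_op nmBC.
    apply: lt_trans (nP j i) _.
    rewrite -[ltRHS]invrK ltf_pV2 ?posrE ?invr_gt0 //.
    apply: lt_le_trans (archi_boundP _) _; first by rewrite invr_ge0 ltW.
    by rewrite ler_nat (leq_trans bj).
  have [m _ /(_ m (leqnn m)) Bm] := cv _ xB.
  by exists (iter (n m).+1 (dsum_op N T) x); split=> //; exists (n m).
(* A recurrent vector in the [eta]-box around [z] would return to its own [eta]-box, against
   [Tz]. *)
move=> rec; have : closure (Rec (dsum_op N.+1 T)) (z : dsum_space X N.+1).
  by rewrite rec.
move=> /(_ _ (nbhs_dsum (z : dsum_space X N.+1) eta0)) [x [xrec /= xz]].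
have [_ [[n _ <-] /= xn]] := xrec _ (nbhs_dsum x eta0).
have [i iz] := Tz x xz n; move: iz; rewrite leNgt => /negP; apply.
have := xn i; rewrite -[X in X - _]/(iter n.+1 (dsum_op N.+1 T) x i).
by rewrite iter_dsum_op.
Qed.

End Transfer.

(** * Real scalars *)

Section RealScalars.
Variable R : realType.

Definition real_scalars_id : real_scalars R R :=
  @RealScalars R R idfun id (fun _ _ => erefl) (fun _ _ => erefl).
Local Notation S := real_scalars_id.

Lemma real_totally_bounded : totally_bounded_scalars S.
Proof.
move=> B del del0; exists [seq i%:R * del - B | i <- iota 0 (Num.bound (2 * B / del))].
move=> a; rewrite -[nm _ _]/`|a| => /ler_normlP[a1 a2].
have q0 : 0 <= (a + B) / del by rewrite divr_ge0 ?(ltW del0) //; lra.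
have /andP[] := truncn_itv q0; set i := Num.truncn _ => i1 i2.
exists (i%:R * del - B).
  apply/mapP; exists i => //; rewrite mem_iota add0n -(ltr_nat R).
  apply: le_lt_trans i1 _; apply: le_lt_trans (archi_boundP _).
    by rewrite ler_pM2r ?invr_gt0 //; lra.
  by rewrite divr_ge0 ?(ltW del0) //; lra.
move: i1 i2; rewrite ler_pdivlMr // ltr_pdivrMr // -natr1 mulrDl mul1r => i1 i2.
by rewrite -[nm _ _]/`|a - _| ger0_norm; lra.
Qed.

Lemma real_separation_property (X : normedModType R) : separation_property S X.
Proof.
move=> V e d V0 Vl d0 dV.
have [||u [ul ub uE]] := @real_separation _ _ S X id V e d _ _ V0 Vl d0 dV.
- by [].
- by move=> a; exact: ler_norm.
have ulin : scalar u.
  move=> a x y; exact: etrans (congr1 u (addrC _ _)) (etrans (ul y x a) (addrC _ _)).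
pose ulM := GRing.isLinear.Build R X R *%R u ulin.
pose g : {scalar X} := HB.pack u ulM.
exists g; split=> [v Vv||x].
- by have := uE v 0 Vv; rewrite scale0r addr0.
- by have := uE 0 1 V0; rewrite scale1r add0r.
apply: le_trans (ub x) _; rewrite ler_wpM2r ?nm_ge0 //.
by rewrite ler_peMl ?invr_ge0 ?ltW //; lra.
Qed.

End RealScalars.

(** * Complex scalars *)

Section ComplexScalars.
Variable R : realType.
Local Notation C := (R[i]).
Local Notation j := ('i%C : C).

(** Left transparent so that [emb] and [rho] compute to the inclusion of the reals and to the real
    part. *)
Definition complex_scalars : real_scalars R C.
Proof.
apply: (@RealScalars R C (real_complex R : {rmorphism R -> C}) (@complex.Re R)).
  exact: lecR.
by move=> a a0; apply: RRe_real; exact: ger0_real.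
Defined.
Local Notation S := complex_scalars.

Lemma norm_Re_le (a : C) : `|complex.Re a| <= nm S a.
Proof. by rewrite -(emb_le S) emb_nm; exact: normc_ge_Re. Qed.

Lemma nm_i : nm S j = 1.
Proof.
have : nm S j * nm S j = 1 by rewrite -nmM -expr2 sqr_i nmN nm1.
by have := nm_ge0 S j; nra.
Qed.

Lemma norm_Im_le (a : C) : `|complex.Im a| <= nm S a.
Proof.
have := norm_Re_le (a * j); rewrite ReiNIm normrN nmM nm_i mulr1; exact.
Qed.

Lemma complex_totally_bounded : totally_bounded_scalars S.
Proof.
move=> B del del0; have [L HL] := @real_totally_bounded R B (del / 2) (divr_gt0 del0 (ltr0Sn _ _)).
exists [seq (x +i* y)%C | x <- L, y <- L] => a aB.
have [x xL xa] := HL (complex.Re a) (le_trans (norm_Re_le a) aB).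
have [y yL ya] := HL (complex.Im a) (le_trans (norm_Im_le a) aB).
exists (x +i* y)%C; first by apply/allpairsP; exists (x, y).
have -> : a - (x +i* y)%C = emb S (complex.Re a - x) + j * emb S (complex.Im a - y).
  by rewrite [LHS]complexE; case: (a).
apply: le_trans (nmD _ _ _) _; rewrite nmM nm_i mul1r !nm_emb.
by move: xa ya; rewrite /nm /=; lra.
Qed.

Lemma complex_separation_property (X : normedModType C) : separation_property S X.
Proof.
move=> V e d V0 Vl d0 dV.
have [||u [ul ub uE]] := @real_separation _ _ S X (@complex.Re R) V e d _ _ V0 Vl d0 dV.
- by move=> [a1 a2] [b1 b2] r /=; rewrite mul0r subr0.
- by move=> a; exact: le_trans (ler_norm _) (norm_Re_le a).
(* The complex-linear form with real part [u]. *)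
pose f x := emb S (u x) - j * emb S (u (j *: x)).
have jj : j * j = -1 by rewrite -expr2 sqr_i.
have uC a x y : u (a *: x + y) = u y + complex.Re a * u x + complex.Im a * u (j *: x).
  have -> : a *: x + y = y + emb S (complex.Re a) *: x + emb S (complex.Im a) *: (j *: x).
    by rewrite scalerA mulrC -addrA -scalerDl -complexE addrC.
  by rewrite !ul.
have flin : scalar f.
  move=> a x y; rewrite /f.
  have -> : j *: (a *: x + y) = a *: (j *: x) + j *: y.
    by rewrite scalerDr !scalerA mulrC.
  rewrite !uC; have -> : j *: (j *: x) = -1 *: x by rewrite scalerA jj.
  have -> : u (-1 *: x) = - u x.
    by have := uC (-1) x 0; rewrite addr0 /=; have := uE 0 0 V0;
      rewrite scale0r addr0 /= => ->; rewrite mulN1r oppr0 mul0r addr0 add0r.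
  have aE : emb S (complex.Re a) + j * emb S (complex.Im a) = a by rewrite [RHS]complexE.
  rewrite -{5}aE !(rmorphD, rmorphM, rmorphN).
  set p := emb S (complex.Re a); set q := emb S (complex.Im a).
  set s := emb S (u x); set t := emb S (u (j *: x)).
  set s' := emb S (u y); set t' := emb S (u (j *: y)).
  apply/eqP; rewrite -subr_eq0; apply/eqP.
  (* For [ring] the imaginary unit is a mere variable, so the multiple of [j^2 + 1] is set apart. *)
  transitivity ((j * j + 1) * (q * t)); first by ring.
  by rewrite jj addNr mul0r.
pose fM := GRing.isLinear.Build C X C *%R f flin.
pose g : {scalar X} := HB.pack f fM.
have uV v k : V v -> u (j *: (v + k *: e)) = complex.Re (j * k).
  move=> Vv; rewrite scalerDr scalerA; apply: uE.
  by have := Vl j _ _ Vv V0; rewrite addr0.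
exists g; split=> [v Vv||x].
- rewrite -[g v]/(f v) /f; have := uE v 0 Vv; have := uV v 0 Vv.
  by rewrite scale0r addr0 mulr0 => -> ->; rewrite rmorph0 mulr0 subr0.
- rewrite -[g e]/(f e) /f; have := uE 0 1 V0; have := uV 0 1 V0.
  by rewrite scale1r add0r mulr1 => -> ->; rewrite rmorph0 mulr0 subr0 rmorph1.
rewrite -[g x]/(f x) /f; apply: le_trans (nmB _ _ _) _; rewrite nmM nm_i mul1r !nm_emb.
have := ub x; have := ub (j *: x); rewrite nmZ nm_i mul1r.
by lra.
Qed.

End ComplexScalars.

Theorem mainTheorem8 (N : nat) (hN : (0 < N)%N) :
  (forall (R : realType) (X : completeNormedModType R),
      separable X -> infinite_dimensional X -> recurrence_gap X N) /\
  (forall (R : realType) (X : completeNormedModType R[i]),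
      separable X -> infinite_dimensional X -> recurrence_gap X N).
Proof.
split=> R X sX infd.
  exact: (@recurrence_gap_of_scalars _ _ (real_scalars_id R) X N
    (@real_separation_property R X) (@real_totally_bounded R) sX infd).
exact: (@recurrence_gap_of_scalars _ _ (complex_scalars R) X N
  (@complex_separation_property R X) (@complex_totally_bounded R) sX infd).
Qed.
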